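(* Let $A, B \in \mathbb{R}^{n\times n}$ be symmetric matrices with $B \geq 0$ and $A$ positive definite. If $$x^{T}Ax - |x|^{T} B |x| > 0 \quad \text{for every } x \in \mathbb{R}^n,\ x \neq 0,$$ then for every $b \in \mathbb{R}^n$ the generalized absolute value equation $Ax - B|x| = b$ has exactly one solution $x \in \mathbb{R}^n$.
   Context: For a vector $x \in \mathbb{R}^n$, $|x|$ denotes the vector of component-wise absolute values of $x$. The inequality $B \ge 0$ is entrywise. *)

(* Defs.v *)
(* MathComp world; the field of real numbers is an arbitrary R : realType. *)
From HB Require Import structures.
From mathcomp Require Import all_boot all_order all_algebra.
From mathcomp Require Import reals.

Set Implicit Arguments.
Unset Strict Implicit.
Unset Printing Implicit Defensive.

Import Order.TTheory GRing.Theory Num.Theory.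
Local Open Scope ring_scope.

(* The 1 x 1 matrix x^T M x, read as a scalar. *)
Definition qform (R : realType) (n : nat) (M : 'M[R]_n) (x : 'cV[R]_n) : R :=
  (x^T *m M *m x) 0 0.

(* Symmetry is not built in. *)
Definition posdefmx (R : realType) (n : nat) (M : 'M[R]_n) : Prop :=
  forall x : 'cV[R]_n, x != 0 -> 0 < qform M x.

Definition absv (R : realType) (n : nat) (x : 'cV[R]_n) : 'cV[R]_n :=
  map_mx Num.norm x.

(* Main.v *)
(* If A z = B w with |w| <= |z| entrywise, then z^T A z = z^T B w <= |z|^T B |z|,
   which forces z = 0. Applied to the difference of two solutions this gives
   uniqueness. For existence, replace each |x_i| by s_i x_i with |s_i| <= 1: the
   equation becomes a linear system, nonsingular by the same fact. The absolute
   values are then restored one index j at a time: solve with x_j and with -x_j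
   in place of |x_j|, obtaining x and y. If neither has the matching sign at j,
   then x_j < 0 < y_j, so |x_j + y_j| <= |x_j - y_j|, and the fact above, applied
   to z = x - y, gives x = y, a contradiction. *)
Require Import Defs.
From mathcomp Require Import all_boot all_order all_algebra.
From mathcomp Require Import reals lra.

Import Order.TTheory GRing.Theory Num.Theory.
Local Open Scope ring_scope.

Lemma bilin_sumE (R : comPzRingType) (n : nat) (M : 'M[R]_n) (x y : 'cV[R]_n) :
  (x^T *m M *m y) 0 0 = \sum_i \sum_j x i 0 * M i j * y j 0.
Proof.
rewrite mxE exchange_big /=; apply: eq_bigr => j _.
by rewrite mxE mulr_suml; apply: eq_bigr => i _; rewrite mxE.
Qed.

(** Leaving [u] and [v] free lets one estimate serve linear, partially restored and full absolute
    values. *)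
Lemma dominated_inj {R : realType} {n : nat} {A B : 'M[R]_n}
    (B_ge0 : forall i j : 'I_n, 0 <= B i j)
    (hAB : forall x : 'cV[R]_n, x != 0 -> 0 < qform A x - qform B (absv x))
    {x y u v : 'cV[R]_n} :
  A *m x - B *m u = A *m y - B *m v ->
  (forall i, `|u i 0 - v i 0| <= `|x i 0 - y i 0|) -> x = y.
Proof.
move=> eqAB le_uv; apply/eqP; rewrite -subr_eq0; apply/negP => /negP /hAB.
have eqz : A *m (x - y) = B *m (u - v).
  move/eqP: eqAB; rewrite subr_eq => /eqP eqAx.
  by rewrite !mulmxBr eqAx addrC 2!addrA addNr add0r addrC.
apply/negP; rewrite -leNgt subr_le0 {1}/qform -mulmxA eqz mulmxA.
rewrite /qform !bilin_sumE; apply: ler_sum => i _; apply: ler_sum => j _.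
apply: le_trans (ler_norm _) _; rewrite !normrM (ger0_norm (B_ge0 i j)) !mxE.
by rewrite ler_wpM2l // mulr_ge0.
Qed.

(** Interpolates between a diagonal linear map ([r] empty) and [absv] ([r] exhausting the
    indices). *)
Definition partial_absv {R : realType} {n : nat} (r : seq 'I_n) (s : 'I_n -> R)
    (x : 'cV[R]_n) : 'cV[R]_n :=
  \col_i (if i \in r then `|x i 0| else s i * x i 0).

Lemma partial_gave_exists {R : realType} {n : nat} {A B : 'M[R]_n}
    (B_ge0 : forall i j : 'I_n, 0 <= B i j)
    (hAB : forall x : 'cV[R]_n, x != 0 -> 0 < qform A x - qform B (absv x))
    (b : 'cV[R]_n) (r : seq 'I_n) (s : 'I_n -> R) :
  (forall i, `|s i| <= 1) ->
  exists x : 'cV[R]_n, A *m x - B *m partial_absv r s x = b.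
Proof.
elim: r s => [|j r IHr] s s_le1.
  pose D := diag_mx (\row_i s i).
  have DE x : partial_absv [::] s x = D *m x.
    by apply/colP => i; rewrite mul_diag_mx !mxE.
  have unitAB : A - B *m D \in unitmx.
    (* [kermx] is a left kernel, hence the transpose; a kernel vector is then compared with the
       solution 0. *)
    rewrite -unitmx_tr -row_free_unit; apply/row_freeP.
    have /eqP ker0 : kermx (A - B *m D)^T == 0.
      apply/rowV0P => v /sub_kermxP /(congr1 trmx).
      rewrite trmx_mul trmxK trmx0 mulmxBl -mulmxA => eqv.
      apply: trmx_inj; rewrite trmx0.
      apply: (dominated_inj B_ge0 hAB (u := D *m v^T) (v := 0)).
        by rewrite eqv !mulmx0 subrr.
      by move=> i; rewrite -DE !mxE !subr0 normrM ler_piMl.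
    by apply/row_freeP; rewrite -kermx_eq0 ker0.
  exists (invmx (A - B *m D) *m b).
  by rewrite DE mulmxA -mulmxBl mulKVmx.
pose t c i := if i == j then c else s i.
have t_le1 c : `|c| = 1 -> forall i, `|t c i| <= 1.
  by move=> c1 i; rewrite /t; case: eqP; rewrite ?c1.
have [|j_notin] := boolP (j \in r).
  move=> j_in; have [x xP] := IHr s s_le1; exists x.
  rewrite -[RHS]xP; congr (_ - _ *m _); apply/colP => i.
  by rewrite !mxE inE; case: eqP => // ->; rewrite j_in.
have restore c (x : 'cV[R]_n) : c * x j 0 = `|x j 0| ->
    partial_absv r (t c) x = partial_absv (j :: r) s x.
  move=> cx; apply/colP => i; rewrite !mxE inE /t.
  by case: eqP => // ->; rewrite (negPf j_notin).
have [x xP] := IHr _ (t_le1 1 (normr1 _)).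
have [y yP] := IHr _ (t_le1 (-1) (normrN1 _)).
have [x_ge0|x_lt0] := leP 0 (x j 0).
  by exists x; rewrite -(restore 1) // mul1r ger0_norm.
have [y_le0|y_gt0] := leP (y j 0) 0.
  by exists y; rewrite -(restore (-1)) // mulN1r ler0_norm.
suff xy : x = y by move: x_lt0 y_gt0; rewrite xy; lra.
apply: (dominated_inj B_ge0 hAB (etrans xP (esym yP))).
move=> i; rewrite !mxE; case: ifP => [_|_]; first exact: ler_dist_dist.
rewrite /t; case: eqP => [->|_].
  (* At [j] the two replacements [x j 0] and [- y j 0] differ by [x j 0 + y j 0], and the opposite
     signs give the bound. *)
  rewrite mul1r mulN1r opprK (ltr0_norm (_ : x j 0 - y j 0 < 0)); last by lra.
  by rewrite ler_norml; lra.
by rewrite -mulrBr normrM ler_piMl.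
Qed.

Theorem theorem7 (R : realType) (n : nat) (A B : 'M[R]_n)
    (symA : A^T = A) (symB : B^T = B)
    (B_ge0 : forall i j : 'I_n, 0 <= B i j)
    (posA : posdefmx A)
    (hAB : forall x : 'cV[R]_n, x != 0 -> 0 < qform A x - qform B (absv x)) :
  forall b : 'cV[R]_n, exists! x : 'cV[R]_n, A *m x - B *m absv x = b.
Proof.
move=> b.
(* The choice [s = 0] is arbitrary: [enum 'I_n] contains every index. *)
have s_le1 (i : 'I_n) : `|(0 : R)| <= 1 by rewrite normr0 ler01.
have [x xP] := partial_gave_exists B_ge0 hAB b (enum 'I_n) _ s_le1.
have absE : partial_absv (enum 'I_n) (fun=> 0) x = absv x.
  by apply/colP => i; rewrite !mxE mem_enum.
rewrite absE in xP; exists x; split=> // y yP.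
apply: (dominated_inj B_ge0 hAB (etrans xP (esym yP))) => i.
by rewrite !mxE; exact: ler_dist_dist.
Qed.
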